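(* Let $j:\omega_1\to[0,1]$ be an injection and let $\mathcal A$ be a maximal almost disjoint family of countably infinite subsets of $\omega_1$ such that for each $a\in\mathcal A$ the set $j(a)$ is a convergent sequence in $[0,1]$. Let $X$ be the one-point compactification of the locally compact space $\Psi(\omega_1,\mathcal A)$. Then $X$ is a scattered compact space with Cantor-Bendixson rank equal to $3$, but $X$ is not a $\Delta$-space.
   Context: A family $\mathcal A$ of countably infinite subsets of an infinite set $D$ is almost disjoint if any two distinct members have finite intersection; it is maximal almost disjoint (MAD) if it is maximal under inclusion among almost disjoint families of countably infinite subsets of $D$. The space $\Psi(D,\mathcal A)$ has underlying set $D\cup\mathcal A$; points of $D$ are isolated, and a base of neighborhoods of $A\in\mathcal A$ consists of all sets $\{A\}\cup B$ where $B\subseteq A$ and $A\setminus B$ is finite. ''$j(a)$ is a convergent sequence'' means that the elements of $j(a)$ can be enumerated one-to-one as a sequence converging to a point of $[0,1]$. A space is scattered if every nonempty closed subset $A$ has a point isolated in $A$. The Cantor-Bendixson rank of a scattered space $X$ is the least ordinal $\alpha$ such that the $\alpha$-th Cantor-Bendixson derivative $X^{(\alpha)}$ is empty (so every $\Psi(D,\mathcal A)$ with $\mathcal A\neq\emptyset$ has rank $2$). A topological space $X$ is a $\Delta$-space if for every decreasing sequence $\{D_n:n\in\omega\}$ of subsets of $X$ with empty intersection there is a decreasing sequence $\{V_n:n\in\omega\}$ of open subsets of $X$, also with empty intersection, such that $D_n\subseteq V_n$ for every $n\in\omega$. *)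

(* Defs.v *)
From HB Require Import structures.
From mathcomp Require Import all_boot all_order all_algebra.
From mathcomp Require Import all_classical all_reals all_analysis.

Set Implicit Arguments.
Unset Strict Implicit.
Unset Printing Implicit Defensive.
Import Order.TTheory GRing.Theory Num.Theory.
Import numFieldNormedType.Exports.
Local Open Scope classical_set_scope.
Local Open Scope ring_scope.

(* These three properties determine a linear order up to isomorphism, as that
   of the first uncountable ordinal. *)
Definition is_omega1 (d : Order.disp_t) (W : orderType d) : Prop :=
  [/\ wochoice.well_order (<=%O : rel W),
      ~ countable [set: W] &
      forall w : W, countable [set v : W | (v < w)%O]].

Section AlmostDisjoint.
Context {D : Type}.
Implicit Types F G : set (set D).

Definition almost_disjoint F : Prop :=
  (forall a, F a -> countable a /\ infinite_set a) /\
  (forall a b, F a -> F b -> a <> b -> finite_set (a `&` b)).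

Definition maximal_almost_disjoint F : Prop :=
  almost_disjoint F /\
  forall G, almost_disjoint G -> F `<=` G -> G = F.

End AlmostDisjoint.

Section Psi.
Context {D : choiceType}.

(* The union of D and the family is a disjoint one: a point [inr a] is never
   identified with a point of D, even if D happens to contain subsets of D. *)
Definition Psi (F : set (set D)) : Type := (D + F)%type.

Variable F : set (set D).

HB.instance Definition _ := Choice.on (Psi F).

Definition Psi_nbhs (x : Psi F) : set_system (Psi F) :=
  match x with
  | inl d => [set U | U (inl d)]
  | inr a => filter_from
      [set B : set D | B `<=` \val a /\ finite_set (\val a `\` B)]
      (fun B => [set inr a] `|` inl @` B)
  end.

Let Psi_filter (x : Psi F) : ProperFilter (Psi_nbhs x).
Proof.
case: x => [d|a] /=.
  split; first by move=> [].
  by split=> [|P Q PU QU|P Q PQ] //; exact: PQ.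
apply: filter_from_proper; last by move=> B _; exists (inr a); left.
apply: filter_from_filter; first by exists (\val a); split=> //; rewrite setDv.
move=> B C [Ba fB] [Ca fC]; exists (B `&` C).
  by split; [exact: subIset (or_introl Ba) | rewrite setDIr finite_setU].
move=> _ [->|[d [Bd Cd] <-]]; first by split; left.
by split; right; exists d.
Qed.

Let Psi_singleton (x : Psi F) (U : set (Psi F)) : Psi_nbhs x U -> U x.
Proof. by case: x => [d|a] // -[B _]; apply; left. Qed.

Let Psi_nbhs_nbhs (x : Psi F) (U : set (Psi F)) :
  Psi_nbhs x U -> Psi_nbhs x (Psi_nbhs^~ U).
Proof.
case: x => [d|a] // -[B BP BU]; exists B => //.
by move=> _ [->|[d Bd <-]] /=; [exists B | apply: BU; right; exists d].
Qed.

HB.instance Definition _ := hasNbhs.Build (Psi F) Psi_nbhs.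

HB.instance Definition _ := @Nbhs_isNbhsTopological.Build (Psi F)
  Psi_filter Psi_singleton Psi_nbhs_nbhs.

End Psi.

Definition convergent_sequence_in01 {R : realType} (S : set R) : Prop :=
  exists (u : nat -> R) (l : R),
    [/\ injective u, range u = S, l \in `[0, 1] & u @ \oo --> l].

(* Ordinals presented as well-founded trees; [osup f] is the supremum of the
   (possibly empty) family [f], so distinct trees may denote the same
   ordinal, and comparison is through [ord_le]. *)
Inductive ord : Type :=
| ozero : ord
| osucc : ord -> ord
| osup (T : Type) (f : T -> ord) : ord.

(* The inner fixpoint decides a < b, read as [osucc a] being below b. *)
Fixpoint ord_le (a : ord) : ord -> Prop :=
  match a with
  | ozero => fun _ => True
  | osucc a' => fix ord_lt (b : ord) : Prop :=
      match b with
      | ozero => False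
      | osucc b' => ord_le a' b'
      | osup _ g => exists i, ord_lt (g i)
      end
  | osup _ f => fun b => forall i, ord_le (f i) b
  end.

Definition ord_of_nat (n : nat) : ord := iter n osucc ozero.

Section CantorBendixson.
Variable X : topologicalType.

Definition scattered : Prop :=
  forall A : set X, closed A -> A !=set0 -> exists x, isolated A x.

(* The derivatives decrease, so the intersection in the [osup] case is the
   usual limit clause, and agrees with the other two clauses when the supremum
   is zero or attained. *)
Fixpoint CB_derivative (a : ord) : set X :=
  match a with
  | ozero => setT
  | osucc a' => CB_derivative a' `\` isolated (CB_derivative a')
  | osup T f => \bigcap_(t in [set: T]) CB_derivative (f t)
  end.

Definition CB_rank_is (a : ord) : Prop :=
  CB_derivative a = set0 /\
  forall b, CB_derivative b = set0 -> ord_le a b.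

(* Compact spaces are Hausdorff, as usual in set-theoretic topology. *)
Definition compact_space : Prop := compact [set: X] /\ hausdorff_space X.

Definition Delta_space : Prop :=
  forall E : nat -> set X,
    nonincreasing_seq E -> \bigcap_n E n = set0 ->
    exists V : nat -> set X,
      [/\ nonincreasing_seq V, (forall n, open (V n)),
          \bigcap_n V n = set0 & forall n, E n `<=` V n].

End CantorBendixson.

(* Main.v *)
Require Import Defs.
From mathcomp Require Import all_boot all_order all_algebra.
From mathcomp Require Import all_classical all_reals all_analysis.
Import Order.TTheory GRing.Theory Num.Theory.
Import numFieldNormedType.Exports.
Local Open Scope classical_set_scope.
Local Open Scope ring_scope.

Set Implicit Arguments.
Unset Strict Implicit.
Unset Printing Implicit Defensive.

(** Write Psi for the space built from the family A, and X for its one-point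
    compactification.

    The topological part is elementary.  Points of W are isolated in X; once
    they are removed every member of A is isolated by its neighborhood
    [Psi_star]; what remains is the point at infinity.  That point survives
    the second derivative because a compact subset of Psi contains only
    finitely many points of the closed discrete set A, while a maximal almost
    disjoint family on an uncountable set is infinite
    ([infinity_nbhs_meets_family]).

    The failure of the Delta property rests on a Bernstein-type colouring h of
    the reals by natural numbers for which every uncountable compact set
    contains points of every colour ([bernstein_partition]).  Let lim a be the
    limit of the convergent sequence j(a), and let E n be the set of all a in
    A with h (lim a) >= n.  These sets decrease to the empty set.  Suppose
    that open sets V n containing E n also decrease to the empty set.  Then W
    is the union of the countably many sets S n = W \ V n, so some S k is
    uncountable, and so is its image under j.  The condensation points of
    j(S k) form an uncountable compact set, hence one of them, x, has colour
    k.  A sequence of points of j(S k) converging to x pulls back to a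
    countably infinite subset of S k; by maximality some a in A meets it in an
    infinite set, which forces lim a = x ([maximal_family_limit]).  Thus a is
    in E k, so V k is a neighborhood of a and contains all but finitely many
    points of a.  But a has infinitely many points in S k, the complement of
    V k: a contradiction.

    The colouring is obtained by transfinite recursion along a well-order of
    the pairs (C, n), C an uncountable compact set of reals, in which the set
    of predecessors of a pair never has the cardinality of all pairs: choose
    for each (C, n) a point of C not chosen before, and colour it n
    ([injective_choice]).  A new point is always available because C has at
    least as many points as there are pairs: a Cantor scheme embeds the
    subsets of nat into C ([uncountable_compact_embedding]), and a pair is
    coded by a subset of nat through a countable base. *)

(** * Injective choice functions *)

Lemma strict_well_order_exists (I : Type) : exists lt : I -> I -> Prop,
  well_founded lt /\ forall x y, x <> y -> lt x y \/ lt y x.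
Proof.
have [le wo_le] := wochoice.well_ordering_principle {classic I}.
have minP (P : set I) : P !=set0 -> exists z,
    [/\ P z, forall x, P x -> le z x &
        forall z', P z' -> (forall x, P x -> le z' x) -> z = z'].
  move=> [x Px]; have [|z [[/asboolP Pz lez] zuniq]] :=
    wo_le (fun y => `[< P y >]); first by exists x; apply/asboolP.
  exists z; split => // [y Py|z' Pz' lez']; first by apply: lez; apply/asboolP.
  by apply: zuniq; split => [|y /asboolP]; [apply/asboolP|exact: lez'].
have refl u : le u u.
  by have [|_ [-> + _]] := minP [set u]; [exists u | apply].
have anti x y : le x y -> le y x -> x = y.
  move=> lexy leyx.
  have [|z [_ _ zuniq]] := minP [set x; y]; first by exists x; left.
  have <- : z = x by apply: zuniq => [|v [] ->]; [left| |].
  by apply: zuniq => [|v [] ->]; [right| |].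
exists (fun x y => ~ le y x); split.
  move=> x; apply: contrapT => xNacc.
  have [|z [zNacc minz _]] := minP [set y | ~ Acc (fun x y => ~ le y x) y].
    by exists x.
  apply: zNacc; constructor => y; apply: contra_notP => yNacc; exact: minz.
by move=> x y xy; apply/not_andP => -[leyx lexy]; apply: xy; exact: anti.
Qed.

(** The type of the order is an initial ordinal.  If some segment of an
    arbitrary well-order contains a copy of I, take the least such segment
    and pull its order back to I along the embedding. *)
Lemma initial_well_order_exists (I : Type) : exists lt : I -> I -> Prop,
  [/\ well_founded lt, forall x y, x <> y -> lt x y \/ lt y x &
      forall y, ~ exists2 k : I -> I, injective k & forall x, lt (k x) y].
Proof.
have [lt [wf tot]] := strict_well_order_exists I.
pose embeds y := exists2 k : I -> I, injective k & forall x, lt (k x) y.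
have [small|/existsNP[y /contrapT emby]] := pselect (forall y, ~ embeds y).
  by exists lt.
have [{}y [{emby}[g g_inj gy] ymin]] : exists y, embeds y /\
    forall x, lt x y -> ~ embeds x.
  elim/(well_founded_ind wf): y emby => y IH emby.
  have [/existsNP[x /not_implyP[xy /contrapT]]|/contrapT] :=
    pselect (~ forall x, lt x y -> ~ embeds x); first exact: IH.
  by exists y.
exists (fun x z => lt (g x) (g z)); split.
(* well-foundedness is inherited along g, by induction on the value g x *)
- move=> x; have [u] : exists u, u = g x by exists (g x).
  elim/(well_founded_ind wf): u x => u IH x ux; constructor => z.
  by rewrite -ux => /IH; apply.
- by move=> x z xz; apply: tot => /g_inj.
- move=> z [k k_inj kz]; apply: (ymin (g z)) => //; exists (g \o k) => //.
  exact: inj_comp.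
Qed.

(** Transfinite recursion along an initial well-order: the values already
    used before stage i cannot exhaust [C i], since otherwise the copy of I
    inside [C i] would embed I into the segment below i. *)
Lemma injective_choice (I T : Type) (C : I -> set T) :
    (forall i, exists2 g : I -> T, injective g & forall x, C i (g x)) ->
  exists2 f : I -> T, injective f & forall i, C i (f i).
Proof.
move=> embC; have [lt [wf tot small]] := initial_well_order_exists I.
have step i (rec : forall x, lt x i -> T) : exists t,
    C i t /\ forall x (xi : lt x i), t <> rec x xi.
  have [g g_inj Cg] := embC i; apply: contrapT => /forallNP noval.
  have /boolp.choice[k kE] : forall x, exists y, exists yi : lt y i,
      g x = rec y yi.
    move=> x.
    have /not_andP[//|/existsNP[y /existsNP[yi /contrapT gxE]]] := noval (g x).
    by exists y, yi.
  apply: (small i); exists k => [x y kxy|x]; last by have [] := kE x.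
  apply: g_inj; have [xi ->] := kE x; have [yi ->] := kE y.
  by rewrite kxy in xi *; rewrite (Prop_irrelevance xi yi).
pose F i rec := sval (cid (step i rec)).
pose f := Fix wf (fun=> T) F.
have fE i : f i = F i (fun x _ => f x).
  apply: Fix_eq => x u v uv; congr F.
  apply: functional_extensionality_dep => y.
  exact: functional_extensionality_dep.
have fP i : C i (f i) /\ forall x, lt x i -> f i <> f x.
  by rewrite fE /F; case: cid => t [].
exists f => [x y fxy|i]; last by case: (fP i).
apply: contrapT => xy; have [xlty|yltx] := tot _ _ xy.
- by have [_ /(_ _ xlty)] := fP y; rewrite fxy.
- by have [_ /(_ _ yltx)] := fP x.
Qed.

(** * Uncountable compact sets *)

Definition condensation_point {T : topologicalType} (S : set T) : set T :=
  [set x | forall U, nbhs x U -> ~ countable (S `&` U)].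

Lemma closed_condensation_point {T : topologicalType} (S : set T) :
  closed (condensation_point S).
Proof.
move=> x clx U xU ctbl.
have [y [yS]] := clx _ (nbhs_interior xU).
by move=> /(yS U)/(_ ctbl).
Qed.

Lemma condensation_point_closure {T : topologicalType} (S : set T) :
  condensation_point S `<=` closure S.
Proof.
move=> x xS U xU; apply/set0P/eqP => SU0.
by apply: (xS U xU); rewrite SU0; exact: countable0.
Qed.

(** Every point removed here lies in a basic open set that meets S in a
    countable set, and there are only countably many basic open sets. *)
Lemma countable_not_condensation {T : topologicalType} (S : set T) :
  @second_countable T -> countable (S `\` condensation_point S).
Proof.
move=> [B ctblB [_ basisB]].
pose N := B `&` [set U | countable (S `&` U)].
apply: (@sub_countable _ _ _ (\bigcup_(U in N) (S `&` U))).
  apply: subset_card_le => x [Sx /existsNP[U /not_implyP[xU /contrapT ctblU]]].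
  have [V [BV Vx] VU] := basisB x U xU; exists V => //; split => //.
  apply: (sub_countable _ ctblU).
  by apply: subset_card_le; exact: setIS.
apply: bigcup_countable => [|U []//].
by apply: (sub_countable _ ctblB); apply/subset_card_le => U [].
Qed.

Lemma uncountableD {T : Type} (S N : set T) :
  countable N -> ~ countable S -> ~ countable (S `\` N).
Proof.
move=> cN cS cSN; apply: cS.
apply: (@sub_countable _ _ _
  (\bigcup_(b in [set: bool]) if b then N else S `\` N)).
  apply: subset_card_le => x Sx; have [Nx|Nx] := pselect (N x).
  - by exists true.
  - by exists false.
by apply: bigcup_countable => [|[]].
Qed.

Lemma uncountable_condensation {T : topologicalType} (S : set T) :
  @second_countable T -> ~ countable S ->
  ~ countable (S `&` condensation_point S).
Proof.
move=> scT cS; rewrite -setDD.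
by apply: uncountableD => //; exact: countable_not_condensation.
Qed.

Section UncountableCompacts.
Context {T : topologicalType}.
Hypotheses (scT : @second_countable T) (hT : hausdorff_space T)
  (rT : regular_space T).

Let big (C : set T) := compact C /\ ~ countable C.

(** Two distinct condensation points of C have disjoint closed neighborhoods,
    each of which meets C in an uncountable set. *)
Lemma compact_uncountable_split (C : set T) : compact C -> ~ countable C ->
  exists C' : bool -> set T,
    (forall b, [/\ C' b `<=` C, compact (C' b) & ~ countable (C' b)]) /\
    C' true `&` C' false = set0.
Proof.
move=> cptC ctblC; have unc := uncountable_condensation scT ctblC.
have [x [Cx Kx]] : C `&` condensation_point C !=set0.
  by apply/set0P/eqP => C0; apply: unc; rewrite C0; exact: countable0.
have [y [[Cy Ky] /eqP yx]] : (C `&` condensation_point C) `\` [set x] !=set0.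
  apply/set0P/eqP => C0; apply: (uncountableD (countable1 x) unc).
  by rewrite C0; exact: countable0.
have := hT; rewrite open_hausdorff => /(_ _ _ yx).
move=> [[U V] /= [yU xV] [oU oV /eqP UV0]].
have [U' yU' clU'U] : filter_from (nbhs y) closure U.
  by apply: rT; apply: open_nbhs_nbhs; split => //; exact: set_mem.
have [V' xV' clV'V] : filter_from (nbhs x) closure V.
  by apply: rT; apply: open_nbhs_nbhs; split => //; exact: set_mem.
have sub (z : T) (W : set T) : condensation_point C z -> nbhs z W ->
    [/\ C `&` closure W `<=` C, compact (C `&` closure W) &
     ~ countable (C `&` closure W)].
  move=> Kz zW; split; first by move=> ? [].
    by apply: compact_closedI => //; exact: closed_closure.
  move=> ctbl; apply: (Kz _ zW); apply: (sub_countable _ ctbl).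
  by apply: subset_card_le; apply: setIS; exact: subset_closure.
exists (fun b : bool => C `&` closure (if b then U' else V')); split => [[]|].
- exact: sub Ky yU'.
- exact: sub Kx xV'.
- rewrite -subset0 => z [[_ /clU'U Uz] [_ /clV'V Vz]].
  by rewrite -UV0; split.
Qed.

Lemma compact_decreasing_nonempty (L : nat -> set T) :
    (forall n, compact (L n)) -> (forall n, L n !=set0) ->
  nonincreasing_seq L -> \bigcap_n L n !=set0.
Proof.
move=> cptL L0 decL.
have FF : ProperFilter (filter_from [set: nat] L).
  apply: filter_from_proper => //.
  apply: filter_from_filter; first by exists 0%N.
  move=> m n _ _; exists (maxn m n) => // x Lx.
  by split; move: x Lx; apply/subsetPset/decL; rewrite ?leq_maxl ?leq_maxr.
have [|p [_ clp]] := cptL 0%N _ FF; first by exists 0%N.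
exists p => n _; apply: (compact_closed hT (cptL n)).
by move=> U pU; apply: clp => //; exists n.
Qed.

(** A Cantor scheme: splitting C repeatedly gives a binary tree of uncountable
    compact sets, and a set K of natural numbers is the branch that turns at
    level n according to whether n is in K. *)
Lemma uncountable_compact_embedding (C : set T) : compact C -> ~ countable C ->
  exists2 p : set nat -> T, injective p & forall K, C (p K).
Proof.
move=> cptC ctblC.
have /boolp.choice[sp spP] : forall D : set T, exists D' : bool -> set T,
    big D -> (forall b, D' b `<=` D /\ big (D' b)) /\
      D' true `&` D' false = set0.
  move=> D; have [[cptD ctblD]|nbig] := pselect (big D); last first.
    by exists (fun=> set0).
  have [D' [D'P D'0]] := compact_uncountable_split cptD ctblD.
  by exists D' => _; split => // b; have [? ? ?] := D'P b.
pose L (K : set nat) := fix L n := if n is m.+1 then sp (L m) `[< K m >] else C.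
have Lbig K n : big (L K n) by elim: n => //= n /spP[/(_ `[< K n >])[]].
have Ldec K n : L K n.+1 `<=` L K n.
  by have [/(_ `[< K n >])[]] := spP _ (Lbig K n).
have /boolp.choice[p pP] : forall K, exists x, forall n, L K n x.
  move=> K; have [| |//|x Lx] := @compact_decreasing_nonempty (L K).
  - by move=> n; have [] := Lbig K n.
  - move=> n; apply/set0P/eqP => L0; have [_] := Lbig K n.
    by rewrite L0; apply; exact: countable0.
  - by apply/nonincreasing_seqP => n; apply/subsetPset.
  - by exists x => n; apply: Lx.
exists p => [K K' pKK'|K]; last exact: (pP K 0%N).
(* branches through a common point never separate: siblings are disjoint *)
have LKK' n : L K n = L K' n /\ K n = K' n.
  elim/ltn_ind: n => n IH; have LE : L K n = L K' n.
    by case: n IH => //= n /(_ _ (ltnSn n))[-> ->].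
  split => //; move: (pP K n.+1) (pP K' n.+1); rewrite -pKK' /= -LE.
  have [_ /seteqP[disj _]] := spP _ (Lbig K n); move: disj.
  case: asboolP => Kn; case: asboolP => K'n disj p1 p2 //.
  - by rewrite propeqE.
  - by case: (disj (p K)).
  - by case: (disj (p K)).
  - by rewrite propeqE.
by apply/funext => n; have [] := LKK' n.
Qed.

(** A compact set is closed, hence determined by the basic open sets that miss
    it; so there are at most as many pairs (C, n) as sets of natural numbers,
    and these embed into every uncountable compact set.  An injective choice
    f (C, n) in C therefore exists, and f (C, n) can be given colour n. *)
Lemma bernstein_partition : exists h : T -> nat, forall C : set T,
  compact C -> ~ countable C -> forall n, exists2 x, C x & h x = n.
Proof.
have [B ctblB [_ basisB]] := scT.
have /countable_injP[e e_inj] := ctblB.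
pose I : Type := ({C : set T | big C} * nat)%type.
pose missed (C : set T) := [set m | exists2 U, B U & e U = m /\ U `&` C = set0].
have missedP C x : closed C ->
    (~ C x) <-> exists U, [/\ B U, U x & missed C (e U)].
  move=> clC; split => [nCx|[U [BU Ux [V BV [/e_inj VU V0]]]] Cx].
    have [U [BU Ux] UC] :=
      basisB x _ (open_nbhs_nbhs (conj (closed_openC clC) nCx)).
    exists U; split => //; exists U => //; split => //.
    by rewrite -subset0 => z [/UC].
  by move: V0; rewrite VU ?inE// -subset0; apply; split; [exact: Ux|exact: Cx].
(* even numbers record the basic sets missing C, odd ones record n *)
pose code (i : I) : set nat :=
  [set m | if odd m then m./2 = i.2 else missed (sval i.1) m./2].
have code_inj : injective code.
  move=> [[C [cptC nC]] m] [[D [cptD nD]] n] /= cE.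
  have mn : m = n.
    have : code (exist _ D (conj cptD nD), n) m.*2.+1.
      by rewrite -cE /code /= odd_double uphalf_double.
    by rewrite /code /= odd_double /= uphalf_double.
  have mE : missed C = missed D.
    apply/funext => k; have := congr1 (fun f => f k.*2) cE.
    by rewrite /code /= odd_double half_double.
  suff CD : C = D.
    rewrite mn; congr (_, _); subst D; congr exist; exact: Prop_irrelevance.
  apply: setC_inj; apply/seteqP; split => x.
  - move=> /(missedP _ _ (compact_closed hT cptC)); rewrite mE.
    by move/(missedP _ _ (compact_closed hT cptD)).
  - move=> /(missedP _ _ (compact_closed hT cptD)); rewrite -mE.
    by move/(missedP _ _ (compact_closed hT cptC)).
have [i|f f_inj fC] := @injective_choice I T (fun i => sval i.1).
  case: i => [[C [cptC nC]] n] /=.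
  have [p p_inj pC] := uncountable_compact_embedding cptC nC.
  by exists (p \o code) => [|x]; [exact: inj_comp p_inj code_inj|exact: pC].
(* points outside the range of f get colour 0 by default *)
have /boolp.choice[h hP] : forall x, exists n, forall i, f i = x -> i.2 = n.
  move=> x; have [[i fi]|nx] := pselect (exists i, f i = x).
    by exists i.2 => j fj; congr snd; apply: f_inj; rewrite fi.
  by exists 0%N => i fi; case: nx; exists i.
exists h => C cptC nC n; pose i : I := (exist _ C (conj cptC nC), n).
by exists (f i); [exact: (fC i)|rewrite -(hP (f i) i)].
Qed.

End UncountableCompacts.

Lemma second_countable_real (R : realType) : @second_countable R.
Proof.
exists (range (fun q : rat * rat => ball (ratr q.1 : R) (ratr q.2))).
  exact: sub_countable (card_image_le _ _) (countableP _).
split=> [_ [q _ <-]|x U]; first exact: ball_open.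
rewrite nbhsE => -[V [oV Vx] VU].
have [c [r [/set_mem xB BV]]] := open_subball_rat oV (mem_set Vx).
exists (ball (ratr c : R) (ratr r)); last exact: subset_trans VU.
by split => //; exists (c, r).
Qed.

(** * Limits of the members of a maximal almost disjoint family *)

(** Otherwise a countably infinite subset of b could be added to the family. *)
Lemma maximal_almost_disjoint_meets {D : Type} (F : set (set D)) (b : set D) :
    maximal_almost_disjoint F -> infinite_set b ->
  exists2 a, F a & infinite_set (a `&` b).
Proof.
move=> [[ctF adF] maxF] infb; apply: contrapT => noa.
have [c [cb ctc infc]] : exists c, [/\ c `<=` b, countable c & infinite_set c].
  have /infiniteP/card_leP[f] := infb.
  pose g (n : nat) : D := val (f (to_setT n)).
  have g_inj : injective g.
    by move=> m n /val_inj/(inj (f := f) (in_setT _) (in_setT _))/(congr1 val).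
  exists (range g); split.
  - by move=> _ [n _ <-]; exact/set_mem/valP.
  - exact: sub_countable (card_image_le _ _) (countableP _).
  - move=> fing; apply: infinite_nat.
    have := finite_preimage (in2W g_inj) fing; apply: sub_finite_set => n _.
    by exists n.
have fin a : F a -> finite_set (a `&` c).
  move=> Fa; apply: contrapT => infac; apply: noa; exists a => //.
  by apply: sub_infinite_set infac => x [ax /cb].
have Fc : F c.
  rewrite -(maxF (F `|` [set c])); [by right| |by move=> a; left].
  split=> [a [/ctF//|->//]|a a' [Fa|->] [Fa'|->] //]; first exact: adF.
  - by move=> _; exact: fin.
  - by move=> _; rewrite setIC; exact: fin.
by apply: infc; rewrite -(setIid c); exact: fin.
Qed.

Lemma finite_range_cvg_diff {T : topologicalType} (u : nat -> T) (l : T)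
    (U : set T) :
  u @ \oo --> l -> nbhs l U -> finite_set (range u `\` U).
Proof.
move=> ul /ul [N _ NU]; apply: (@sub_finite_set _ _ (u @` `I_N)); last first.
  exact: finite_image (finite_II N).
move=> _ [[n _ <-] nU]; exists n => //=; rewrite ltnNge.
by apply/negP => Nn; apply: nU; exact: NU.
Qed.

(** Disjoint neighborhoods of two different limits would each contain all but
    finitely many of the common values. *)
Lemma infinite_range_meet_cvg_unique {T : topologicalType} (u v : nat -> T)
    (l m : T) :
  hausdorff_space T -> u @ \oo --> l -> v @ \oo --> m ->
  infinite_set (range u `&` range v) -> l = m.
Proof.
move=> hT ul vm inf; apply: hT => U V lU mV; apply: contrapT => UV0; apply: inf.
apply: (@sub_finite_set _ _ ((range u `\` U) `|` (range v `\` V))).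
  move=> x [ux vx]; have [Ux|nUx] := pselect (U x); last by left.
  by right; split => // Vx; apply: UV0; exists x.
by rewrite finite_setU; split;
  [exact: finite_range_cvg_diff ul lU|exact: finite_range_cvg_diff vm mV].
Qed.

Lemma condensation_sequence (R : realType) (S : set R) (x : R) :
  condensation_point S x -> exists u : nat -> R,
    [/\ range u `<=` S, infinite_set (range u) & u @ \oo --> x].
Proof.
move=> Sx; have /limit_pointP[u [uS ux ucvg]] : limit_point S x.
  apply/limit_point_infinite_setP => U xU; rewrite setIC => fin.
  by apply: (Sx U xU); exact: finite_set_countable.
exists u; split => //.
have : limit_point (range u) x by apply/limit_pointP; exists u; split => // ?.
by move/limit_point_infinite_setP/(_ _ filterT); rewrite setTI.
Qed.

(** This is where maximality enters the argument: the limits of the members of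
    A that meet S in an infinite set include all condensation points of
    [j @` S], hence an uncountable closed set when S is uncountable. *)
Lemma maximal_family_limit (R : realType) (W : Type) (j : W -> R)
    (A : set (set W)) (lim : set W -> R) (S : set W) (x : R) :
    injective j -> maximal_almost_disjoint A ->
    (forall a, A a -> exists2 u : nat -> R, range u = j @` a &
       u @ \oo --> lim a) ->
  condensation_point (j @` S) x ->
  exists a, [/\ A a, lim a = x & infinite_set (a `&` S)].
Proof.
move=> j_inj madA limA /condensation_sequence[u [uS infu ux]].
pose b := S `&` j @^-1` range u.
have jb : j @` b = range u.
  apply/seteqP; split=> [_ [w [_ uw] <-]//|y uy].
  by have [w Sw jw] := uS _ uy; exists w => //; split => //; rewrite /= jw.
have [|a Aa infab] := maximal_almost_disjoint_meets madA (b := b).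
  by move=> finb; apply: infu; rewrite -jb; exact: finite_image.
exists a; split => //; last by apply: sub_infinite_set infab => w [aw []].
have [v va vl] := limA a Aa.
apply: (infinite_range_meet_cvg_unique (@Rhausdorff R) vl ux).
rewrite va => fin; apply: infab.
apply: sub_finite_set (finite_preimage (in2W j_inj) fin) => w [aw [_ uw]].
by split => //; exists w.
Qed.

(** * Failure of the Delta property *)

Lemma open_Psi_compactification {D : choiceType} (F : set (set D)) (a : F)
    (V : set (one_point_compactification (Psi F))) :
  open V -> V (Some (inr a)) ->
  finite_set (val a `\` [set w | V (Some (inl w))]).
Proof.
rewrite openE => oV /oV [B [Ba finB] BV]; apply: sub_finite_set finB.
by move=> w [aw nVw]; split => // Bw; apply: nVw; apply: BV; right; exists w.
Qed.

(** The witness is the sequence of the sets of those members of A whose limit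
    has Bernstein colour at least n. *)
Lemma not_Delta_space (R : realType) (W : choiceType) (j : W -> R)
    (A : set (set W)) : ~ countable [set: W] ->
    (forall w, j w \in `[0, 1]) -> injective j -> maximal_almost_disjoint A ->
    (forall a, A a -> convergent_sequence_in01 (j @` a)) ->
  ~ Delta_space (one_point_compactification (Psi A)).
Proof.
move=> unW j01 j_inj madA convA.
have [h hP] := bernstein_partition (second_countable_real R) (@Rhausdorff R)
  (fun x : R => @uniform_regular R x).
have /boolp.choice[lim limA] : forall a : set W, exists l : R, A a ->
    exists2 u : nat -> R, range u = j @` a & u @ \oo --> l.
  move=> a; have [Aa|nAa] := pselect (A a); last by exists 0.
  by have [u [l [_ ua _ ul]]] := convA a Aa; exists l => _; exists u.
pose E n : set (one_point_compactification (Psi A)) :=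
  [set x | if x is Some (inr a) then (n <= h (lim (val a)))%N else False].
move=> /(_ E)[| |V [decV oV V0 EV]].
- move=> m n mn; apply/subsetPset => -[[w|a]|] //=; exact: leq_trans.
- rewrite -subset0 => -[[w|a]|] En; try exact: (En 0%N I).
  by have := En (h (lim (val a))).+1 I; rewrite /= ltnn.
pose S n := [set w : W | ~ V n (Some (inl w))].
have [k unS] : exists k, ~ countable (S k).
  apply/existsNP => ctS; apply: unW.
  apply: sub_countable
    (@bigcup_countable _ _ [set: nat] S (countableP _) _) => //.
  apply: subset_card_le => w _; apply: contrapT => Sw.
  have : (\bigcap_n V n) (Some (inl w)).
    by move=> n _; apply: contrapT => Vw; apply: Sw; exists n.
  by rewrite V0.
have unjS : ~ countable (j @` S k).
  by rewrite (eq_countable (inj_card_eq (in2W j_inj))).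
pose C : set R := condensation_point (j @` S k).
have cptC : compact C.
  apply: (@subclosed_compact _ _ (`[0, 1]%classic : set R)).
  - exact: closed_condensation_point.
  - exact: segment_compact.
  - move=> x /condensation_point_closure clx.
    have cl01 : closed (`[0, 1]%classic : set R) by exact: itv_closed.
    apply: cl01; move: x clx; apply: closure_subset.
    by move=> _ [w _ <-]; exact: j01.
have unC : ~ countable C.
  move=> ctC; apply: (uncountable_condensation (second_countable_real R) unjS).
  by apply: sub_countable ctC; apply: subset_card_le => x [].
have [x Cx hx] := hP C cptC unC k.
have [a [Aa lima infaS]] := maximal_family_limit j_inj madA limA Cx.
apply: infaS.
have EVa : V k (Some (inr (exist _ a (mem_set Aa)))).
  by apply: EV; rewrite /E /= lima hx.
exact: (open_Psi_compactification (oV k) EVa).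
Qed.

(** * The space Psi and its compactification *)

Lemma one_point_compactification_hausdorff {X : topologicalType} :
    hausdorff_space X -> (forall x : X, exists2 K, nbhs x K & compact K) ->
  hausdorff_space (one_point_compactification X).
Proof.
move=> hX lcX.
have sepNone (x : X) :
    ~ cluster (nbhs (Some x : one_point_compactification X)) None.
  have [K xK cptK] := lcX x => clx.
  have [||_ [[y Ky <-] [[z nKz [zy]]|//]]] :=
    clx (Some @` K) ((Some @` (~` K)) `|` [set None]).
  - exact: one_point_compactification_some_nbhs.
  - by exists K => //; split => //; exact: compact_closed.
  - by apply: nKz; rewrite zy.
move=> [x|] [y|] // clxy.
- congr Some; apply: hX => U V xU yV.
  have [||_ [[z Uz <-] [t Vt [tz]]]] := clxy (Some @` U) (Some @` V).
  + exact: one_point_compactification_some_nbhs.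
  + exact: one_point_compactification_some_nbhs.
  + by exists z; split => //; rewrite -tz.
- by case: (sepNone x clxy).
- case: (sepNone y) => U V yU NV; have [z [Vz Uz]] := clxy V U NV yU.
  by exists z.
Qed.

Section PsiTopology.
Context {D : choiceType} (F : set (set D)).
Local Notation X := (one_point_compactification (Psi F)).

(** The largest basic neighborhood of a point: it witnesses local compactness,
    and it isolates each member of F within F. *)
Definition Psi_star (x : Psi F) : set (Psi F) :=
  match x with
  | inl d => [set inl d]
  | inr a => [set inr a] `|` inl @` val a
  end.

Lemma Psi_nbhs_star (x : Psi F) : nbhs x (Psi_star x).
Proof.
by case: x => [d|a] //=; exists (val a) => //; split => //; rewrite setDv.
Qed.

Lemma open_Psi_star (x : Psi F) : open (Psi_star x).
Proof.
rewrite openE => y; case: x => [d|a] /= => [->|]; first by [].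
move=> [->|[d ad <-]]; first exact: (Psi_nbhs_star (inr a)).
by right; exists d.
Qed.

(** A convergent sequence together with its limit: a filter on it that does
    not cluster at a lives on a finite set. *)
Lemma compact_Psi_star (x : Psi F) : compact (Psi_star x).
Proof.
case: x => [d|a] /=; first exact: compact_set1.
move=> G GF GK; apply: contrapT => nocl.
have /existsNP[P /existsNP[U /not_implyP[GP /not_implyP[aU PU0]]]] :
    ~ cluster G (inr a).
  by move=> cla; apply: nocl; exists (inr a); split => //; left.
have [B [Ba finB] BU] := aU.
(* P avoids the neighborhood B of a, so G lives on the finite set a minus B *)
have finS : finite_set (inl @` (val a `\` B) : set (Psi F)).
  exact: finite_image.
have [|y [[d [ad _] <-] cly]] := finite_compact finS GF.
  apply: filterS (filterI GK GP) => y [[->|[d ad <-]] Py].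
    by case: PU0; exists (inr a); split => //; apply: BU; left.
  exists d => //; split => // Bd; case: PU0; exists (inl d).
  by split => //; apply: BU; right; exists d.
by apply: nocl; exists (inl d); split => //; right; exists d.
Qed.

Lemma Psi_hausdorff : almost_disjoint F -> hausdorff_space (Psi F).
Proof.
move=> [_ adF] x y cl.
have sep (d : D) (a : F) :
    ~ (nbhs (inl d : Psi F) `#` nbhs (inr a : Psi F)).
  move=> /(_ [set inl d] ([set inr a] `|` inl @` (val a `\ d)))[//||].
    exists (val a `\ d) => //; split; first exact: subDsetl.
    by rewrite setDD; exact: finite_setIr.
  by move=> z [-> [//|[e [_ ed] [de]]]]; apply: ed.
case: x y cl => [d|a] [e|b] cl.
- by have [_ [-> ->]] := cl [set inl d] [set inl e] erefl erefl.
- by case: (sep d b cl).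
- by case: (sep e a); rewrite meetsC.
- congr inr; apply: val_inj; apply: contrapT => ab.
  have finab := adF _ _ (set_valP a) (set_valP b) ab.
  have [||z] := cl ([set inr a] `|` inl @` (val a `\` val b))
                   ([set inr b] `|` inl @` (val b `\` val a)).
  + by exists (val a `\` val b) => //; split; [exact: subDsetl|rewrite setDD].
  + exists (val b `\` val a) => //; split; first exact: subDsetl.
    by rewrite setDD setIC.
  + move=> [[->|[d [ad bd] <-]] [zb|[e [be ae] ze]]] //.
    * by case: zb => zb; apply: ab; rewrite zb.
    * by case: ze => ed; apply: bd; rewrite -ed.
Qed.

Lemma Psi_compactification_compact : almost_disjoint F -> compact_space X.
Proof.
move=> adF; split; first exact: one_point_compactification_compact.
apply: one_point_compactification_hausdorff; first exact: Psi_hausdorff.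
move=> x; exists (Psi_star x); first exact: Psi_nbhs_star.
exact: compact_Psi_star.
Qed.

End PsiTopology.

(** * Cantor-Bendixson derivatives *)

Lemma isolated_subset {T : topologicalType} (A B : set T) (x : T) :
  A `<=` B -> A x -> isolated B x -> isolated A x.
Proof.
move=> AB Ax [_ [V xV VB]]; split; first exact: mem_set.
exists V => //; apply/seteqP; split => [y [Vy /AB By]|_ ->].
  by rewrite -VB; split.
by split => //; exact: nbhs_singleton.
Qed.

Lemma CB_derivative_ord_of_natS (T : topologicalType) (n : nat) :
  @CB_derivative T (ord_of_nat n.+1) =
  @CB_derivative T (ord_of_nat n) `\`
    isolated (@CB_derivative T (ord_of_nat n)).
Proof. by []. Qed.

(** Failure of n + 1 <= b means b <= n, and derivatives decrease.  Stated with
    a negation, it goes by induction on b without any comparison of trees. *)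
Lemma CB_derivative_not_ord_le (T : topologicalType) (n : nat) (b : ord) :
  ~ ord_le (ord_of_nat n.+1) b ->
  @CB_derivative T (ord_of_nat n) `<=` @CB_derivative T b.
Proof.
elim: b n => [|b IH|I f IH] n //=.
- case: n => [|n]; first by move=> /(_ I).
  move=> nle; have sub := IH n nle => x [Dx niso]; split; first exact: sub.
  by move: niso; apply: contra_not; exact: isolated_subset.
- move=> /forallNP nle x Dx i _; exact: IH (nle i) x Dx.
Qed.

(** A countable family of countable sets leaves infinitely many points of D
    uncovered, which contradicts maximality. *)
Lemma maximal_almost_disjoint_uncountable {D : Type} (F s : set (set D)) :
    maximal_almost_disjoint F -> ~ countable [set: D] -> countable s ->
  exists2 a, F a & ~ s a.
Proof.
move=> madF unD cts; apply: contrapT => nos.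
have Fs a : F a -> s a.
  by move=> Fa; apply: contrapT => nsa; apply: nos; exists a.
have ctF : countable (\bigcup_(a in F) a).
  apply: bigcup_countable => [|a Fa]; last by case: madF => -[/(_ _ Fa)[]].
  exact: sub_countable (subset_card_le Fs) cts.
have inf : infinite_set (~` \bigcup_(a in F) a).
  move=> fin; apply: (uncountableD ctF unD).
  by rewrite setTD; exact: finite_set_countable.
have [a Fa] := maximal_almost_disjoint_meets madF inf; apply.
by rewrite (_ : _ `&` _ = set0) // -subset0 => d [ad]; apply; exists a.
Qed.

Section PsiDerivatives.
Context {D : choiceType} (F : set (set D)).
Hypotheses (madF : maximal_almost_disjoint F) (unD : ~ countable [set: D]).
Local Notation X := (one_point_compactification (Psi F)).

(** Otherwise a compact set K contains the infinite family F.  The cofinite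
    subsets of F then form a filter on K, which cannot cluster anywhere since
    every point has a neighborhood with at most one point of F. *)
Lemma infinity_nbhs_meets_family (V : set X) :
  nbhs (None : X) V -> exists a : F, V (Some (inr a)).
Proof.
move=> [K [cptK _] KV]; apply: contrapT => /forallNP VF.
have FK (a : F) : K (inr a).
  by apply: contrapT => nKa; apply: (VF a); apply: KV; left; exists (inr a).
pose tails := filter_from finite_set (fun s : set (Psi F) => range inr `\` s).
have PF : ProperFilter tails.
  apply: filter_from_proper => [|s fins].
    apply: filter_from_filter; first by exists set0.
    move=> s t fins fint; exists (s `|` t); first by rewrite finite_setU.
    by rewrite setDUr.
  pose sets (x : Psi F) := if x is inr a then val a else set0.
  have [a Fa nsa] := maximal_almost_disjoint_uncountable madF unD
    (finite_set_countable (finite_image sets fins)).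
  pose a' : F := exist _ a (mem_set Fa).
  exists (inr a'); split; first by exists a'.
  by move=> sa; apply: nsa; exists (inr a').
have [|x [_ clx]] := cptK tails PF.
  by exists set0 => // _ [[a _ <-] _]; exact: FK.
have [|y [[[a _ <-] ax]]] := clx (range inr `\` [set x]) _ _ (Psi_nbhs_star x).
  by exists [set x].
by case: x ax {clx} => [d|b] ax //= [|[]//]; exact: ax.
Qed.

Lemma isolated_Psi_point (C : set X) (w : D) :
  C (Some (inl w)) -> isolated C (Some (inl w)).
Proof.
move=> Cw; split; first exact: mem_set.
exists [set Some (inl w)] => //; apply/seteqP; split => [_ [-> _]//|_ ->].
by split.
Qed.

Lemma isolated_Psi_family (C : set X) (a : F) :
  (forall w, ~ C (Some (inl w))) -> C (Some (inr a)) ->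
  isolated C (Some (inr a)).
Proof.
move=> Cw Ca; split; first exact: mem_set.
exists (Some @` Psi_star (inr a)).
  by apply: one_point_compactification_some_nbhs; exact: Psi_nbhs_star.
apply/seteqP; split => [_ [[_ [->|[w _ <-]] <-]] // /Cw //|_ ->].
by split => //; exists (inr a) => //; left.
Qed.

Lemma scattered_Psi_compactification : scattered X.
Proof.
move=> C _ [x Cx].
have [[w Cw]|/forallNP Cw] := pselect (exists w, C (Some (inl w))).
  by exists (Some (inl w)); exact: isolated_Psi_point.
have [[a Ca]|/forallNP Ca] := pselect (exists a, C (Some (inr a))).
  by exists (Some (inr a)); exact: isolated_Psi_family.
exists x; split; first exact: mem_set.
exists setT; first exact: filterT.
have noneP y : C y -> y = None by case: y => [[w /Cw|a /Ca]|].
rewrite setTI; apply/seteqP.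
by split => [y /noneP ->|_ ->//]; rewrite (noneP x).
Qed.

Let not_isolated_infinity (C : set X) :
  (forall a : F, C (Some (inr a))) -> ~ isolated C None.
Proof.
move=> CF [_ [V NV VC]]; have [a Va] := infinity_nbhs_meets_family NV.
have : (V `&` C) (Some (inr a)) by split.
by rewrite VC.
Qed.

Lemma CB_derivative1_Psi :
  @CB_derivative X (ord_of_nat 1) = ~` [set Some (inl w) | w in [set: D]].
Proof.
apply/seteqP; split => [x [_ niso] [w _ wx]|x xw].
  by apply: niso; rewrite -wx; exact: isolated_Psi_point.
split => //; case: x xw => [[w|a]|] xw.
- by case: xw; exists w.
- move=> [_ [V aV VT]].
  have [B [Ba finB] BV] := aV.
  have [w Bw] : B !=set0.
    apply/set0P/eqP => B0; have [_] := madF.1.1 _ (set_valP a); apply.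
    by rewrite -(setD0 (val a)) -B0.
  have : (V `&` setT) (Some (inl w)) by split => //; apply: BV; right; exists w.
  by rewrite VT.
- exact: not_isolated_infinity.
Qed.

Lemma CB_derivative2_Psi : @CB_derivative X (ord_of_nat 2) = [set None].
Proof.
rewrite (@CB_derivative_ord_of_natS X 1) CB_derivative1_Psi.
apply/seteqP; split => [[[w|a]|]|_ ->].
- by move=> [[]]; exists w.
- move=> [Ca []]; apply: isolated_Psi_family => // w; apply; by exists w.
- by [].
- split; first by move=> [].
  by apply: not_isolated_infinity => a [].
Qed.

Lemma CB_rank_Psi : CB_rank_is X (ord_of_nat 3).
Proof.
split.
  rewrite (@CB_derivative_ord_of_natS X 2) CB_derivative2_Psi.
  rewrite -subset0 => x [->]; apply.
  split; first exact: mem_set.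
  by exists setT; [exact: filterT|rewrite setTI].
move=> b b0; apply: contrapT => /(@CB_derivative_not_ord_le X 2 b).
by rewrite CB_derivative2_Psi b0 => /(_ None); apply.
Qed.

End PsiDerivatives.

Theorem corollary4p6 (R : realType) (d : Order.disp_t) (W : orderType d)
    (hW : is_omega1 W)
    (j : W -> R) (j01 : forall w : W, j w \in `[0, 1]) (j_inj : injective j)
    (A : set (set W)) (madA : maximal_almost_disjoint A)
    (convA : forall a : set W, A a -> convergent_sequence_in01 (j @` a)) :
  let X := one_point_compactification (Psi A) in
  [/\ scattered X, compact_space X, CB_rank_is X (ord_of_nat 3)
    & ~ Delta_space X].
Proof.
have [_ unW _] := hW; split.
- exact: scattered_Psi_compactification.
- by apply: Psi_compactification_compact; case: madA.
- exact: CB_rank_Psi.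
- exact: not_Delta_space convA.
Qed.
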